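(* Let $K$ be a field of characteristic not $2$ or $3$. The supercommutator algebra $(A,[\cdot,\cdot])$ of any right alternative superalgebra $A=A_0\oplus A_1$ over $K$ is a Bol superalgebra; that is, there is a ternary operation $\{\cdot,\cdot,\cdot\}$ on $A$ such that $(A,[\cdot,\cdot],\{\cdot,\cdot,\cdot\})$ is a Bol superalgebra.
   Context: A superspace is a $\mathbb{Z}_2$-graded vector space $A=A_0\oplus A_1$; an element $x\in A_i$ is homogeneous of degree $\bar x=i$. A superalgebra is a superspace $A$ (not necessarily associative or unital) with a bilinear product, written $xy$, satisfying $A_iA_j\subset A_{i+j}$. With the associator $as(x,y,z):=(xy)z-x(yz)$, the superalgebra $A$ is right alternative if $as(x,y,z)=-(-1)^{\bar y\bar z}as(x,z,y)$ for all homogeneous $x,y,z\in A$. The supercommutator algebra of a superalgebra $A$ is the superspace $A$ with the bilinear product given on homogeneous elements by $[x,y]:=\tfrac12\big(xy-(-1)^{\bar x\bar y}yx\big)$. A Bol superalgebra is a triple $(A,[\cdot,\cdot],\{\cdot,\cdot,\cdot\})$ where $A$ is a superspace, $[\cdot,\cdot]$ is a bilinear and $\{\cdot,\cdot,\cdot\}$ a trilinear operation on $A$, both compatible with the grading ($[A_i,A_j]\subset A_{i+j}$, $\{A_i,A_j,A_k\}\subset A_{i+j+k}$), such that for all homogeneous $u,v,w,x,y,z\in A$: (SB1) $[x,y]=-(-1)^{\bar x\bar y}[y,x]$; (SB2) $\{x,y,z\}=-(-1)^{\bar x\bar y}\{y,x,z\}$; (SB3) $\{x,y,z\}+(-1)^{\bar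 x(\bar y+\bar z)}\{y,z,x\}+(-1)^{\bar z(\bar x+\bar y)}\{z,x,y\}=0$; (SB4) $\{x,y,[u,v]\}=[\{x,y,u\},v]+(-1)^{\bar u(\bar x+\bar y)}[u,\{x,y,v\}]+(-1)^{(\bar x+\bar y)(\bar u+\bar v)}\big(\{u,v,[x,y]\}-[[u,v],[x,y]]\big)$; (SB5) $\{x,y,\{u,v,w\}\}=\{\{x,y,u\},v,w\}+(-1)^{\bar u(\bar x+\bar y)}\{u,\{x,y,v\},w\}+(-1)^{(\bar x+\bar y)(\bar u+\bar v)}\{u,v,\{x,y,w\}\}$. *)

(* Defs.v *)
From HB Require Import structures.
From mathcomp Require Import all_boot all_order all_algebra.
Set Implicit Arguments.
Unset Strict Implicit.
Unset Printing Implicit Defensive.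
Import GRing.Theory.
Local Open Scope ring_scope.

(* Degrees live in Z/2, encoded as bool: [false] is 0, [true] is 1, and the sum
   of degrees is [addb], written (+). In the exponent of a sign only the parity
   matters, so there degrees are coerced to nat and combined with nat + and *.
   The zero vector is homogeneous of both degrees. *)
Record superspace (K : fieldType) := Superspace {
  space_of :> lmodType K;
  grade : bool -> submodClosed space_of;
  grade_sum : forall x : space_of, exists x0 x1 : space_of,
    [/\ x0 \in grade false, x1 \in grade true & x = x0 + x1];
  grade_cap : forall x : space_of,
    x \in grade false -> x \in grade true -> x = 0
}.

Section Components.
Variables (K : fieldType) (A : superspace K).
Implicit Types x y z : A.

Lemma gcomp_subproof x : exists p : A * A,
  [&& p.1 \in grade A false, p.2 \in grade A true & x == p.1 + p.2].
Proof.
by have [x0 [x1 [h0 h1 ->]]] := grade_sum x; exists (x0, x1); rewrite h0 h1 /=.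
Qed.

(* [gcomp i x] is the homogeneous component of degree i of x. *)
Definition gcomp (i : bool) x : A :=
  let p := xchoose (gcomp_subproof x) in if i then p.2 else p.1.

Lemma gcomp_grade i x : gcomp i x \in grade A i.
Proof.
by rewrite /gcomp; have /and3P[] := xchooseP (gcomp_subproof x); case: i.
Qed.

Lemma gcomp_sum x : x = gcomp false x + gcomp true x.
Proof. by have /and3P[_ _ /eqP] := xchooseP (gcomp_subproof x). Qed.

Lemma gradeB i x y : x \in grade A i -> y \in grade A i -> x - y \in grade A i.
Proof. exact: (GRing.submod_closedB (submodClosedP (grade A i))).2. Qed.

Lemma gcomp_uniq x x0 x1 :
  x0 \in grade A false -> x1 \in grade A true -> x = x0 + x1 ->
  gcomp false x = x0 /\ gcomp true x = x1.
Proof.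
move=> h0 h1 def_x.
have e : gcomp false x - x0 = x1 - gcomp true x.
  apply/eqP; rewrite -subr_eq0 opprB addrACA -opprD subr_eq0 -gcomp_sum.
  exact/eqP.
have z0 : gcomp false x - x0 = 0.
  apply: grade_cap; first by apply: gradeB; rewrite ?gcomp_grade.
  by rewrite e; apply: gradeB; rewrite ?gcomp_grade.
split; first by apply/eqP; rewrite -subr_eq0 z0.
by apply/eqP; rewrite eq_sym -subr_eq0 -e z0.
Qed.

Lemma gcomp_homog i j x : x \in grade A i -> gcomp j x = if i == j then x else 0.
Proof.
move=> hx; case: i hx => hx.
  by have [] := gcomp_uniq (rpred0 _) hx (esym (add0r x)); case: j.
by have [] := gcomp_uniq hx (rpred0 _) (esym (addr0 x)); case: j.
Qed.

Fact gcomp_is_linear i : linear (gcomp i).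
Proof.
move=> a x y.
have [] := @gcomp_uniq (a *: x + y) (a *: gcomp false x + gcomp false y)
                                    (a *: gcomp true x + gcomp true y).
- by apply: rpredD; rewrite ?gcomp_grade //; apply: rpredZ; rewrite gcomp_grade.
- by apply: rpredD; rewrite ?gcomp_grade //; apply: rpredZ; rewrite gcomp_grade.
- by rewrite addrACA -scalerDr -!gcomp_sum.
by case: i.
Qed.

HB.instance Definition _ i := GRing.isLinear.Build K A A *:%R (gcomp i)
  (gcomp_is_linear i).

End Components.

Record superalgebra (K : fieldType) := Superalgebra {
  superspace_of :> superspace K;
  smul : {bilinear superspace_of -> superspace_of -> superspace_of};
  smul_grade : forall (i j : bool) (x y : superspace_of),
    x \in grade superspace_of i -> y \in grade superspace_of j ->
    smul x y \in grade superspace_of (i (+) j)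
}.

Section Superalgebras.
Variables (K : fieldType) (A : superalgebra K).
Implicit Types x y z : A.

Definition associator x y z : A :=
  smul A (smul A x y) z - smul A x (smul A y z).

Definition right_alternative : Prop :=
  forall (i j k : bool) x y z,
    x \in grade A i -> y \in grade A j -> z \in grade A k ->
    associator x y z = - ((-1) ^+ (j * k) *: associator x z y).

(* The bilinear extension of the supercommutator of homogeneous elements;
   see [supercomm_homog] and [supercomm_bilinear]. *)
Definition supercomm x y : A :=
  \sum_(i : bool) \sum_(j : bool)
    2^-1 *: (smul A (gcomp i x) (gcomp j y)
             - (-1) ^+ (i * j) *: smul A (gcomp j y) (gcomp i x)).

Lemma supercomm_homog i j x y : x \in grade A i -> y \in grade A j ->
  supercomm x y = 2^-1 *: (smul A x y - (-1) ^+ (i * j) *: smul A y x).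
Proof.
move=> hx hy; rewrite /supercomm (bigD1 i) //= (bigD1 j) //=.
rewrite !(gcomp_homog _ hx) !(gcomp_homog _ hy) !eqxx.
rewrite [X in _ + X + _]big1 ?addr0 => [|k /negPf nkj]; last first.
  rewrite (gcomp_homog _ hy) eq_sym nkj linear0r linear0l.
  by rewrite scaler0 subr0 scaler0.
rewrite big1 ?addr0 // => k /negPf nki; rewrite big1 // => l _.
by rewrite (gcomp_homog _ hx) eq_sym nki linear0r linear0l scaler0 subr0 scaler0.
Qed.

Lemma supercomm_bilinear :
  (forall y, linear (supercomm^~ y)) /\ (forall x, linear (supercomm x)).
Proof.
split=> [y a x x' | x a y y']; rewrite /supercomm scaler_sumr -big_split /=;
  apply: eq_bigr => i _; rewrite scaler_sumr -big_split /=;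
  apply: eq_bigr => j _; rewrite linearP linearPr linearPl /=;
  rewrite scalerA (mulrC a) -scalerA -scalerDr; congr (_ *: _);
  by rewrite scalerBr addrACA scalerDr opprD !scalerA (mulrC a).
Qed.

End Superalgebras.

Record bol_superalgebra (K : fieldType) (A : superspace K)
    (br : A -> A -> A) (tr : A -> A -> A -> A) : Prop := BolSuperalgebra {
  bol_linear2l : forall y, linear (br^~ y);
  bol_linear2r : forall x, linear (br x);
  bol_linear3l : forall y z, linear (fun x => tr x y z);
  bol_linear3m : forall x z, linear (fun y => tr x y z);
  bol_linear3r : forall x y, linear (tr x y);
  bol_grade2 : forall (i j : bool) (x y : A),
    x \in grade A i -> y \in grade A j -> br x y \in grade A (i (+) j);
  bol_grade3 : forall (i j k : bool) (x y z : A),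
    x \in grade A i -> y \in grade A j -> z \in grade A k ->
    tr x y z \in grade A (i (+) j (+) k);
  bol_SB1 : forall (i j : bool) (x y : A),
    x \in grade A i -> y \in grade A j ->
    br x y = - ((-1) ^+ (i * j) *: br y x);
  bol_SB2 : forall (i j k : bool) (x y z : A),
    x \in grade A i -> y \in grade A j -> z \in grade A k ->
    tr x y z = - ((-1) ^+ (i * j) *: tr y x z);
  bol_SB3 : forall (i j k : bool) (x y z : A),
    x \in grade A i -> y \in grade A j -> z \in grade A k ->
    tr x y z + (-1) ^+ (i * (j + k)) *: tr y z x
             + (-1) ^+ (k * (i + j)) *: tr z x y = 0;
  bol_SB4 : forall (i j k l : bool) (x y u v : A),
    x \in grade A i -> y \in grade A j -> u \in grade A k -> v \in grade A l ->
    tr x y (br u v) =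
      br (tr x y u) v
      + (-1) ^+ (k * (i + j)) *: br u (tr x y v)
      + (-1) ^+ ((i + j) * (k + l)) *: (tr u v (br x y) - br (br u v) (br x y));
  bol_SB5 : forall (i j k l m : bool) (x y u v w : A),
    x \in grade A i -> y \in grade A j ->
    u \in grade A k -> v \in grade A l -> w \in grade A m ->
    tr x y (tr u v w) =
      tr (tr x y u) v w
      + (-1) ^+ (k * (i + j)) *: tr u (tr x y v) w
      + (-1) ^+ ((i + j) * (k + l)) *: tr u v (tr x y w)
}.

(* Main.v *)
(* Right alternativity says exactly that x |-> R_x, right multiplication on the
   unital hull K 1 + A, turns the Jordan superproduct of A into that of the
   operators. The double supercommutator [[R_x, R_y], R_z] is a Jordan
   expression, so it equals R_q for an element q = q(x, y, z) of A, which is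
   recovered as the image of 1; the Bol triple product is q(x, y, z) / 4.
   SB2 and SB3 are the skew-symmetry and the super Jacobi identity of the double
   supercommutator, SB5 says that the inner superderivation given by [R_x, R_y]
   preserves it, and in SB4 both sides reduce to the same combination of
   [x, y][u, v] and of the operator [R_x, R_y] applied to [u, v]. *)
From HB Require Import structures.
Require Import Defs.
From mathcomp Require Import all_boot all_order all_algebra.
From mathcomp Require Import ring.
Set Implicit Arguments.
Unset Strict Implicit.
Unset Printing Implicit Defensive.
Import GRing.Theory.
Local Open Scope ring_scope.

(** * Normalisation of additive identities, and signs *)

(* Atoms are compared by [unify], since rewriting leaves convertible but
   syntactically different canonical instances in them. *)
Ltac bring_pos a :=
  match goal with
  | |- _ + (?n + _) = 0 => unify n a
  | |- context[?x + (?n + ?r)] => unify n a; rewrite (addrCA x n r); bring_pos a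
  end.

Ltac bring_neg a :=
  match goal with
  | |- _ + (- ?n + _) = 0 => unify n a
  | |- context[?x + (- ?n + ?r)] =>
      unify n a; rewrite (addrCA x (- n) r); bring_neg a
  end.

(** Everything moves to one side, where each leading summand cancels against an opposite one further
    right; scalar multiples count as atoms. *)
Ltac abel :=
  apply/eqP; rewrite -subr_eq0;
  match goal with |- is_true (?s == 0) => rewrite -[s]addr0 end; apply/eqP;
  rewrite ?(opprD, opprK, oppr0) -?addrA ?add0r;
  repeat (lazymatch goal with
  | |- - ?a + _ = 0 => bring_pos a; rewrite (addKr a)
  | |- ?a + _ = 0 => bring_neg a; rewrite (addNKr a)
  end); reflexivity.

Lemma signDl (R : pzRingType) (i j k : bool) :
  (-1) ^+ ((i (+) j) * k) = (-1) ^+ (i * k) * (-1) ^+ (j * k) :> R.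
Proof. by case: i j k => [] [] []; rewrite /= ?mulr1 ?mul1r ?mulrNN ?mulr1. Qed.

Lemma signDr (R : pzRingType) (i j k : bool) :
  (-1) ^+ (k * (i (+) j)) = (-1) ^+ (k * i) * (-1) ^+ (k * j) :> R.
Proof. by rewrite mulnC signDl !(mulnC k). Qed.

(** * Super Jacobi identity for signed commutators of operators *)

Section SignedCommutator.
Variables (K : fieldType) (V : lmodType K).
Implicit Types (a : K) (p : V).

(* Operators act on the right, so the product of f and g is "f, then g". *)
Definition scomm a (f g : V -> V) p : V := g (f p) - a *: f (g p).

Lemma eq_scomm a f f' g g' : f =1 f' -> g =1 g' -> scomm a f g =1 scomm a f' g'.
Proof. by move=> ef eg p; rewrite /scomm !ef !eg. Qed.

Fact scomm_is_linear a (f g : {linear V -> V}) : linear (scomm a f g).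
Proof.
move=> k p q; rewrite /scomm !(linearP f, linearP g) !scalerDr scalerN !scalerA.
rewrite (mulrC a); abel.
Qed.

HB.instance Definition _ a (f g : {linear V -> V}) :=
  GRing.isLinear.Build K V V *:%R (scomm a f g) (scomm_is_linear a f g).

Lemma scommDl a b (f f' g : {linear V -> V}) p :
  scomm a (fun q => f q + b *: f' q) g p = scomm a f g p + b *: scomm a f' g p.
Proof.
rewrite /scomm linearD linearZ /= scalerDr scalerBr !scalerA (mulrC a); abel.
Qed.

Let linB (f : {linear V -> V}) p q : f (p - q) = f p - f q.
Proof. exact: linearB. Qed.

Let linZ (f : {linear V -> V}) a p : f (a *: p) = a *: f p.
Proof. exact: linearZ. Qed.

(** The exponents belong to the pairs (f, g), (f, h) and (g, h) and are independent, so [f], [g],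
    [h] may themselves be commutators, of any degrees. *)
Lemma scomm_jacobi (i j k : nat) (f g h : {linear V -> V}) p :
  scomm ((-1) ^+ i * (-1) ^+ j) f (scomm ((-1) ^+ k) g h) p =
    scomm ((-1) ^+ j * (-1) ^+ k) (scomm ((-1) ^+ i) f g) h p
    + (-1) ^+ i *: scomm ((-1) ^+ i * (-1) ^+ k) g (scomm ((-1) ^+ j) f h) p.
Proof.
rewrite /scomm !(linB f, linB g, linB h) !(linZ f, linZ g, linZ h).
rewrite -(signr_odd K i) -(signr_odd K j) -(signr_odd K k).
case: (odd i) (odd j) (odd k) => [] [] [];
  rewrite /= ?expr0 ?expr1 ?mulr1 ?mul1r ?mulrNN ?mulr1;
  rewrite ?(scaleN1r, scale1r, opprK); abel.
Qed.

End SignedCommutator.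

(** * Triple products represented faithfully by double commutators *)

Section OperatorTriple.
Variables (K : fieldType) (V H : lmodType K) (gr : bool -> V -> Prop).
Variables (R : V -> {linear H -> H}) (q : V -> V -> V -> V).
Local Notation s i j := ((-1) ^+ (i * j) : K).
Hypothesis R_linear : forall p a x y, R (a *: x + y) p = a *: R x p + R y p.
Hypothesis R_inj : forall x y, R x =1 R y -> x = y.
Hypothesis q_grade : forall i j k x y z,
  gr i x -> gr j y -> gr k z -> gr (i (+) j (+) k) (q x y z).
Hypothesis R_q : forall i j k x y z, gr i x -> gr j y -> gr k z ->
  R (q x y z) =1 scomm (s (i (+) j) k) (scomm (s i j) (R x) (R y)) (R z).

(** By injectivity of [R] the identity may be checked on operators. There [q x y] becomes the
    bracket with [R_x, R_y], which the super Jacobi identity makes a superderivation; it is used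
    once on [[R_u, R_v], R_w] and once on [R_u, R_v]. *)
Lemma operator_triple_derivation (i j k l m : bool) x y u v w :
    gr i x -> gr j y -> gr k u -> gr l v -> gr m w ->
  q x y (q u v w) = q (q x y u) v w
    + s (i (+) j) k *: q u (q x y v) w
    + s (i (+) j) (k (+) l) *: q u v (q x y w).
Proof.
move=> hx hy hu hv hw; apply: R_inj => p.
(* [R_linear] wants the scaled summand on the left, so the sum is reversed for it and then
   restored. *)
rewrite addrC [q (q x y u) v w + _]addrC !R_linear [RHS]addrC.
rewrite [X in _ = X + _]addrC.
have grD t n : gr n t -> gr (i (+) j (+) n) (q x y t) by exact: q_grade.
rewrite (R_q hx hy (q_grade hu hv hw)).
rewrite (R_q (grD _ _ hu) hv hw) (R_q hu (grD _ _ hv) hw).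
rewrite (R_q hu hv (grD _ _ hw)).
rewrite (eq_scomm _ (frefl _) (R_q hu hv hw)).
rewrite [scomm _ _ (R (q x y w)) p](eq_scomm _ (frefl _) (R_q hx hy hw)).
rewrite signDr scomm_jacobi (signDr _ _ _ (k (+) l)) (mulnC _ (k (+) l)).
rewrite (mulnC (k (+) l) (i (+) j)).
congr (_ + _).
(* The inner use of Jacobi: [R_x, R_y] acting on [R_u, R_v]. *)
have e r : scomm (s (i (+) j) (k (+) l)) (scomm (s i j) (R x) (R y))
    (scomm (s k l) (R u) (R v)) r =
  scomm (s (i (+) j (+) k) l) (R (q x y u)) (R v) r
  + s (i (+) j) k *: scomm (s k (i (+) j (+) l)) (R u) (R (q x y v)) r.
  rewrite (eq_scomm _ (R_q hx hy hu) (frefl _)).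
  rewrite (eq_scomm _ (frefl _) (R_q hx hy hv)).
  by rewrite signDr scomm_jacobi -signDl signDr (mulnC k (i (+) j)).
rewrite (eq_scomm _ e (frefl _)) scommDl -signDl.
by congr (scomm _ _ _ _ + _ *: scomm _ _ _ _); congr (s _ _);
  case: i j k l {hx hy hu hv grD e} => [] [] [] [].
Qed.

End OperatorTriple.

(** * A globally trilinear formula for the triple product *)

Section BilinearTriple.
Variables (K : fieldType) (V : lmodType K) (f g : V -> V -> V).
Hypotheses (fl : forall y, linear (f^~ y)) (fr : forall x, linear (f x)).
Hypotheses (gl : forall y, linear (g^~ y)) (gr : forall x, linear (g x)).

(* With f the product and g x y = (-1)^(xy) y x, this is the trilinear extension
   of [[R_x, R_y], R_z] applied to 1. The word (zx)y is not a nesting of f and g,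
   so right alternativity is used to replace (zx)y - (-1)^(xy) (zy)x by
   z(xy + (-1)^(xy) yx) - 2 (-1)^(xy) (zy)x. *)
Definition bilinear_triple x y z : V :=
  f (f x y - g x y) z - g (f x y + g x y) z + 2 *: g x (g y z).

Let fDl x y z : f (x + y) z = f x z + f y z.
Proof. by rewrite -[x]scale1r fl !scale1r. Qed.
Let gDl x y z : g (x + y) z = g x z + g y z.
Proof. by rewrite -[x]scale1r gl !scale1r. Qed.
Let fNl x z : f (- x) z = - f x z.
Proof. by have /= := scalable_linear (fl z) (-1) x; rewrite !scaleN1r. Qed.

Lemma bilinear_triple_linearl y z : linear (fun x => bilinear_triple x y z).
Proof.
move=> a x x'; rewrite /bilinear_triple !(fl, gl, opprD, fDl, gDl, fNl).
rewrite !(scalerDr, scalerN) !scalerA (mulrC a 2); abel.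
Qed.

Lemma bilinear_triple_linearm x z : linear (fun y => bilinear_triple x y z).
Proof.
move=> a y y'; rewrite /bilinear_triple !(fl, gl, fr, gr, opprD, fDl, gDl, fNl).
rewrite !(scalerDr, scalerN) !scalerA (mulrC a 2); abel.
Qed.

Lemma bilinear_triple_linearr x y : linear (bilinear_triple x y).
Proof.
move=> a z z'; rewrite /bilinear_triple !(fr, gr).
rewrite !(scalerDr, scalerN) !scalerA (mulrC a 2); abel.
Qed.

End BilinearTriple.

(** The super-opposite product: subtracting twice the supercommutator leaves (-1)^(xy) yx on
    homogeneous elements, and bilinearity is inherited. *)
Definition sop (K : fieldType) (A : superalgebra K) (x y : A) : A :=
  smul A x y - 2 *: supercomm x y.

(* Locked, since unification would otherwise unfold it down to [gcomp]. *)
HB.lock Definition qtriple (K : fieldType) (A : superalgebra K) (x y z : A) :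
  A := bilinear_triple (smul A) (@sop K A) x y z.

(** * Jordan superproducts in a right alternative superalgebra *)

Section RightAlternative.
Variables (K : fieldType) (A : superalgebra K).
Hypothesis charK : 2%N \notin [pchar K].
Hypothesis hA : right_alternative A.
Implicit Types (i j k l : bool) (x y z u v w : A).

Local Notation mul := (smul A).
Local Notation s i j := ((-1) ^+ (i * j) : K).

Let neq2 : 2 != 0 :> K.
Proof. by have := charK; rewrite inE. Qed.

Local Notation sop := (@sop K A).
Local Notation qtriple := (@qtriple K A).

Lemma sop_homog i j x y : x \in grade A i -> y \in grade A j ->
  sop x y = s i j *: mul y x.
Proof.
move=> hx hy; rewrite /sop (supercomm_homog hx hy) scalerA divff // scale1r.
by rewrite opprB addrC subrK.
Qed.

Lemma sop_linearl y : linear (sop^~ y).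
Proof.
move=> a x x'; rewrite /sop (supercomm_bilinear A).1 linearPl /=.
rewrite !scalerDr scalerN !scalerA (mulrC a); abel.
Qed.

Lemma sop_linearr x : linear (sop x).
Proof.
move=> a y y'; rewrite /sop (supercomm_bilinear A).2 linearPr /=.
rewrite !scalerDr scalerN !scalerA (mulrC a); abel.
Qed.

Let mulDl z x y : mul (x + y) z = mul x z + mul y z.
Proof. exact: linearDl. Qed.
Let mulDr z x y : mul z (x + y) = mul z x + mul z y.
Proof. exact: linearDr. Qed.
Let mulNl x z : mul (- x) z = - mul x z.
Proof. exact: linearNl. Qed.
Let mulNr z x : mul z (- x) = - mul z x.
Proof. exact: linearNr. Qed.
Let mulZl a x z : mul (a *: x) z = a *: mul x z.
Proof. exact: (linearZl_LR (smul A)). Qed.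
Let mulZr a z x : mul z (a *: x) = a *: mul z x.
Proof. exact: (linearZr_LR (smul A)). Qed.
Let mulE := (mulDl, mulDr, mulNl, mulNr, mulZl, mulZr).

Let gradeM i j x y : x \in grade A i -> y \in grade A j ->
  mul x y \in grade A (i (+) j).
Proof. exact: smul_grade. Qed.

Let gradeM' i j x y : x \in grade A i -> y \in grade A j ->
  mul y x \in grade A (i (+) j).
Proof. by rewrite addbC => *; apply: smul_grade. Qed.

(** Twice the Jordan superproduct when [a] is the sign of the pair. The sign is an argument because
    an element does not determine its degree. *)
Definition sjord a x y : A := mul x y + a *: mul y x.

Lemma sjord_grade a i j x y : x \in grade A i -> y \in grade A j ->
  sjord a x y \in grade A (i (+) j).
Proof.
move=> hx hy; apply: rpredD; first exact: gradeM.
by apply: rpredZ; apply: gradeM'.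
Qed.

(** This is right alternativity with the associators expanded. Its sign does not involve the degree
    of [z], so summing over components gives it for every [z]. *)
Lemma mul_sjord i j x y z : x \in grade A i -> y \in grade A j ->
  mul z (sjord (s i j) x y) = mul (mul z x) y + s i j *: mul (mul z y) x.
Proof.
move=> hx hy; rewrite /sjord.
have H k : mul (gcomp k z) (mul x y) + s i j *: mul (gcomp k z) (mul y x)
  = mul (mul (gcomp k z) x) y + s i j *: mul (mul (gcomp k z) y) x.
  have /eqP := hA (gcomp_grade k z) hx hy.
  rewrite /associator; case: i j {hx hy} => [] [] /=;
  rewrite ?expr0 ?expr1 ?scaleN1r ?scale1r ?opprK -subr_eq0 => /eqP e;
  apply/eqP; rewrite -subr_eq0 -oppr_eq0 -e; apply/eqP; abel.
rewrite [z]gcomp_sum !mulE !H !scalerDr; abel.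
Qed.

(** The product R_x R_y R_z sends 1 to (xy)z, whence four left-normed words; [mul_sjord] undoes the
    replacement made in [bilinear_triple]. *)
Lemma qtripleE i j k x y z :
    x \in grade A i -> y \in grade A j -> z \in grade A k ->
  qtriple x y z = mul (mul x y) z - s i j *: mul (mul y x) z
    - s (i (+) j) k *: (mul (mul z x) y - s i j *: mul (mul z y) x).
Proof.
move=> hx hy hz; rewrite qtriple.unlock /bilinear_triple.
rewrite (sop_homog hy hz) (sop_homog hx hy).
have hzy : s j k *: mul z y \in grade A (j (+) k) by apply/rpredZ/gradeM'.
rewrite (sop_homog hx hzy) (sop_homog (sjord_grade (s i j) hx hy) hz).
rewrite (mul_sjord _ hx hy) !mulE scaler_nat mulr2n.
case: i j k {hx hy hz hzy} => [] [] []; rewrite /= ?expr0 ?expr1;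
rewrite ?(scaleN1r, scale1r, opprK); abel.
Qed.

(** Super form of the associative identity [[a, b], c] = a∘(b∘c) - b∘(a∘c), where a∘b = ab + ba. *)
Lemma qtriple_sjord i j k x y z :
    x \in grade A i -> y \in grade A j -> z \in grade A k ->
  qtriple x y z = sjord (s i (j (+) k)) x (sjord (s j k) y z)
    - s i j *: sjord (s j (i (+) k)) y (sjord (s i k) x z).
Proof.
move=> hx hy hz; rewrite (qtripleE hx hy hz).
rewrite [sjord _ x (sjord _ _ _)]/sjord [sjord _ y (sjord _ _ _)]/sjord.
rewrite (mul_sjord _ hx hz) (mul_sjord _ hy hz) /sjord !mulE.
case: i j k {hx hy hz} => [] [] []; rewrite /= ?expr0 ?expr1;
rewrite ?(scaleN1r, scale1r, opprK); abel.
Qed.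

Lemma qtriple_grade i j k x y z :
    x \in grade A i -> y \in grade A j -> z \in grade A k ->
  qtriple x y z \in grade A (i (+) j (+) k).
Proof.
move=> hx hy hz; rewrite (qtriple_sjord hx hy hz) -addbA; apply: gradeB.
  by do 2 apply: sjord_grade => //.
by rewrite addbCA; apply: rpredZ; do 2 apply: sjord_grade => //.
Qed.

(** * Right multiplications on the unital hull *)

(* Right multiplication by x on the unital hull K 1 + A. *)
Definition rmul x (p : K^o * A) : K^o * A := (0, p.1 *: x + mul p.2 x).

Fact rmul_is_linear x : linear (rmul x).
Proof.
move=> a p q; rewrite /rmul /= !mulE; congr (_, _) => /=.
  by rewrite scaler0 addr0.
by rewrite scalerDl scalerDr -scalerA addrACA.
Qed.

HB.instance Definition _ x :=
  GRing.isLinear.Build K (K^o * A)%type (K^o * A)%type *:%R (rmul x) (rmul_is_linear x).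

Let rmulDl x y p : rmul (x + y) p = rmul x p + rmul y p.
Proof.
rewrite /rmul mulDr scalerDr; congr (_, _) => /=; first by rewrite addr0.
by rewrite addrACA.
Qed.

Let rmulZl a x p : rmul (a *: x) p = a *: rmul x p.
Proof.
rewrite /rmul mulZr; congr (_, _) => /=; first by rewrite scaler0.
by rewrite scalerDr !scalerA mulrC.
Qed.

Let rmulD x p q : rmul x (p + q) = rmul x p + rmul x q.
Proof. exact: linearD. Qed.

Let rmulZ a x p : rmul x (a *: p) = a *: rmul x p.
Proof. exact: linearZ. Qed.

(** The adjoined unit (1, 0) recovers [x], even if [A] has no unit of its own. *)
Lemma rmul_inj x y : rmul x =1 rmul y -> x = y.
Proof. by move/(_ (1, 0)) => []; rewrite !scale1r !linear0l !addr0. Qed.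

Lemma rmul_sjord i j x y p : x \in grade A i -> y \in grade A j ->
  rmul (sjord (s i j) x y) p = rmul y (rmul x p) + s i j *: rmul x (rmul y p).
Proof.
move=> hx hy; rewrite /rmul (mul_sjord _ hx hy) /= !scale0r !add0r !mulE.
congr (_, _) => /=; first by rewrite scaler0 addr0.
by rewrite /sjord !scalerDr !scalerA mulrC addrACA.
Qed.

(** [qtriple_sjord] uses only Jordan superproducts, which [rmul_sjord] carries to operators; there
    the same identity is read backwards. *)
Lemma rmul_qtriple i j k x y z :
    x \in grade A i -> y \in grade A j -> z \in grade A k ->
  rmul (qtriple x y z)
    =1 scomm (s (i (+) j) k) (scomm (s i j) (rmul x) (rmul y)) (rmul z).
Proof.
move=> hx hy hz p; rewrite (qtriple_sjord hx hy hz).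
rewrite -scaleNr rmulDl rmulZl /scomm.
rewrite (rmul_sjord _ hx (sjord_grade _ hy hz)).
rewrite (rmul_sjord _ hy (sjord_grade _ hx hz)).
rewrite !(rmul_sjord _ hx hz) !(rmul_sjord _ hy hz) -!scaleNr.
rewrite !(rmulD, rmulZ).
case: i j k {hx hy hz} => [] [] []; rewrite /= ?expr0 ?expr1;
rewrite ?(scaleN1r, scale1r, opprK); abel.
Qed.

Lemma qtriple_derivation i j k l m x y u v w :
    x \in grade A i -> y \in grade A j ->
    u \in grade A k -> v \in grade A l -> w \in grade A m ->
  qtriple x y (qtriple u v w) =
    qtriple (qtriple x y u) v w
    + s (i (+) j) k *: qtriple u (qtriple x y v) w
    + s (i (+) j) (k (+) l) *: qtriple u v (qtriple x y w).
Proof.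
apply: (@operator_triple_derivation _ _ _ (fun i x => x \in grade A i)
  (fun x => rmul x : {linear _ -> _})) => [p a x0 y0|x0 y0||] /=.
- by rewrite rmulDl rmulZl.
- exact: rmul_inj.
- exact: qtriple_grade.
- exact: rmul_qtriple.
Qed.

Lemma mul_qtriple i j k x y z t :
    x \in grade A i -> y \in grade A j -> z \in grade A k ->
  mul t (qtriple x y z) =
    mul (mul (mul t x) y) z - s i j *: mul (mul (mul t y) x) z
    - s (i (+) j) k *: (mul (mul (mul t z) x) y
                            - s i j *: mul (mul (mul t z) y) x).
Proof.
(* Evaluation at an element of [A] instead of at the unit. *)
move=> hx hy hz; have /(congr1 snd) := rmul_qtriple hx hy hz (0, t).
by rewrite /scomm /rmul /= !(scale0r, scaler0, oppr0, add0r) => ->;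
  rewrite !mulE.
Qed.

(** * The binary and ternary identities before normalisation *)

Lemma qtriple_skew i j k x y z :
    x \in grade A i -> y \in grade A j -> z \in grade A k ->
  qtriple x y z = - (s i j *: qtriple y x z).
Proof.
move=> hx hy hz; rewrite (qtripleE hx hy hz) (qtripleE hy hx hz).
case: i j k {hx hy hz} => [] [] []; rewrite /= ?expr0 ?expr1;
rewrite ?(scaleN1r, scale1r, opprK); abel.
Qed.

(** Each of the six left-normed words in x, y, z occurs twice, with opposite signs. *)
Lemma qtriple_cyclic i j k x y z :
    x \in grade A i -> y \in grade A j -> z \in grade A k ->
  qtriple x y z + s i (j (+) k) *: qtriple y z x
    + s k (i (+) j) *: qtriple z x y = 0.
Proof.
move=> hx hy hz.
rewrite (qtripleE hx hy hz) (qtripleE hy hz hx) (qtripleE hz hx hy).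
case: i j k {hx hy hz} => [] [] []; rewrite /= ?expr0 ?expr1;
rewrite ?(scaleN1r, scale1r, opprK); abel.
Qed.

Definition comm a x y : A := mul x y - a *: mul y x.

Lemma comm_grade a i j x y : x \in grade A i -> y \in grade A j ->
  comm a x y \in grade A (i (+) j).
Proof.
move=> hx hy; apply: gradeB; first exact: gradeM.
by apply: rpredZ; apply: gradeM'.
Qed.

(* The operator t |-> t [R_x, R_y], acting on the right. *)
Let D a x y t : A := mul (mul t x) y - a *: mul (mul t y) x.

Let D_comm a x y b u v :
  D a x y (comm b u v) = D a x y (mul u v) - b *: D a x y (mul v u).
Proof.
rewrite /comm /D !mulE !scalerDr !scalerN !scalerA (mulrC a); abel.
Qed.

Let qtripleD i j k x y z :
    x \in grade A i -> y \in grade A j -> z \in grade A k ->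
  qtriple x y z = mul (comm (s i j) x y) z - s (i (+) j) k *: D (s i j) x y z.
Proof. by move=> hx hy hz; rewrite (qtripleE hx hy hz) /comm !mulE. Qed.

Let mul_qtripleD i j k x y z t :
    x \in grade A i -> y \in grade A j -> z \in grade A k ->
  mul t (qtriple x y z) =
    mul (D (s i j) x y t) z - s (i (+) j) k *: D (s i j) x y (mul t z).
Proof. by move=> hx hy hz; rewrite (mul_qtriple _ hx hy hz) /D !mulE. Qed.

Let qtriple_mulD i j k x y z t :
    x \in grade A i -> y \in grade A j -> z \in grade A k ->
  mul (qtriple x y z) t =
    mul (mul (comm (s i j) x y) z) t - s (i (+) j) k *: mul (D (s i j) x y z) t.
Proof. by move=> hx hy hz; rewrite (qtripleD hx hy hz) mulDl mulNl mulZl. Qed.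

(** Write c = [x, y] and let D be the operator of [R_x, R_y]. The terms (cu)v and (cv)u cancel
    against [R_u, R_v] applied to c, and (Du)v and (Dv)u cancel between the first two commutators.
    What is left is c[u, v] and D applied to uv and vu. *)
Lemma qtriple_comm i j k l x y u v :
    x \in grade A i -> y \in grade A j ->
    u \in grade A k -> v \in grade A l ->
  qtriple x y (comm (s k l) u v) =
    comm (s (i (+) j (+) k) l) (qtriple x y u) v
    + s k (i (+) j) *: comm (s k (i (+) j (+) l)) u (qtriple x y v)
    + s (i (+) j) (k (+) l) *: (qtriple u v (comm (s i j) x y)
        - comm (s (k (+) l) (i (+) j)) (comm (s k l) u v) (comm (s i j) x y)).
Proof.
move=> hx hy hu hv.
have huv := comm_grade (s k l) hu hv; have hxy := comm_grade (s i j) hx hy.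
rewrite (qtripleD hx hy huv) (qtripleD hu hv hxy).
rewrite [comm _ (qtriple _ _ _) v]/comm [comm _ u (qtriple _ _ _)]/comm [comm _ (comm _ u v) _]/comm.
rewrite (mul_qtripleD _ hx hy hu) (mul_qtripleD _ hx hy hv).
rewrite (qtriple_mulD _ hx hy hu) (qtriple_mulD _ hx hy hv) (D_comm _ x y).
rewrite [D _ u v _]/D.
have sC p q : s p q = s q p by rewrite mulnC.
rewrite !(sC k) !(sC (k (+) l)) !signDr !signDl (sC l k).
rewrite -(signDl _ i j k) -(signDl _ i j l).
move: (comm _ x y) (comm _ u v) (D _ x y) => c c' d.
(* All signs are now products of three independent ones, so eight cases suffice. *)
have signP n : (-1) ^+ n = 1 :> K \/ (-1) ^+ n = -1 :> K.
  by rewrite -signr_odd; case: odd; [right|left].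
case: (signP (k * l)%N) (signP ((i (+) j) * k)%N) (signP ((i (+) j) * l)%N);
  case=> -> [] -> [] ->; rewrite ?(mulr1, mul1r, mulrNN);
  rewrite ?(scaleN1r, scale1r, opprK); abel.
Qed.

(** * Normalisation and the Bol axioms *)

Let supercommE i j x y : x \in grade A i -> y \in grade A j ->
  supercomm x y = 2^-1 *: comm (s i j) x y.
Proof. exact: supercomm_homog. Qed.

(** The factor balances SB4: three nested brackets carry 1/8, and so does one bracket combined with
    one triple product. *)
Definition triple x y z : A := 4^-1 *: qtriple x y z.

Let mul_linearl y : linear ((smul A)^~ y).
Proof. by move=> a x x'; rewrite linearPl. Qed.

Let mul_linearr x : linear (smul A x).
Proof. by move=> a y y'; rewrite linearPr. Qed.

Lemma qtriple_linearl y z : linear (fun x => qtriple x y z).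
Proof.
rewrite qtriple.unlock; apply: bilinear_triple_linearl;
  [apply: mul_linearl | apply: sop_linearl].
Qed.

Lemma qtriple_linearm x z : linear (fun y => qtriple x y z).
Proof.
rewrite qtriple.unlock; apply: bilinear_triple_linearm;
  [apply: mul_linearl|apply: mul_linearr|apply: sop_linearl|apply: sop_linearr].
Qed.

Lemma qtriple_linearr x y : linear (qtriple x y).
Proof.
rewrite qtriple.unlock; apply: bilinear_triple_linearr;
  [apply: mul_linearr | apply: sop_linearr].
Qed.

Let qtZl a x y z : qtriple (a *: x) y z = a *: qtriple x y z.
Proof. exact: (scalable_linear (qtriple_linearl y z)). Qed.

Let qtZm a x y z : qtriple x (a *: y) z = a *: qtriple x y z.
Proof. exact: (scalable_linear (qtriple_linearm x z)). Qed.

Let qtZr a x y z : qtriple x y (a *: z) = a *: qtriple x y z.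
Proof. exact: (scalable_linear (qtriple_linearr x y)). Qed.

(** The axioms add degrees in [nat], the preceding identities in Z/2; the sign sees only parity. *)
Let sign_addr (n : nat) i j :
  (-1) ^+ (n * (i + j)) = (-1) ^+ (n * (i (+) j)) :> K.
Proof. by rewrite -signr_odd -[RHS]signr_odd !oddM oddD !oddb. Qed.

Let sign_addl (n : nat) i j :
  (-1) ^+ ((i + j) * n) = (-1) ^+ ((i (+) j) * n) :> K.
Proof. by rewrite -signr_odd -[RHS]signr_odd !oddM oddD !oddb. Qed.

Let scaleC a b x : a *: (b *: x) = b *: (a *: x).
Proof. by rewrite !scalerA mulrC. Qed.

Let commZl a b x y : comm a (b *: x) y = b *: comm a x y.
Proof. by rewrite /comm mulZl mulZr scaleC -scalerBr. Qed.

Let commZr a b x y : comm a x (b *: y) = b *: comm a x y.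
Proof. by rewrite /comm mulZl mulZr scaleC -scalerBr. Qed.

Let rescale a b x y z w :
  4^-1 *: (2^-1 *: (x + a *: y + b *: (z - w))) =
    2^-1 *: (4^-1 *: x) + a *: (2^-1 *: (4^-1 *: y))
    + b *: (4^-1 *: (2^-1 *: z) - 2^-1 *: (2^-1 *: (2^-1 *: w))).
Proof.
have -> : 4^-1 = 2^-1 * 2^-1 :> K by rewrite -invfM -natrM.
rewrite !(scalerDr, scalerN) !scalerA; move: 2^-1 => c.
by congr (_ *: _ + _ *: _ + (_ *: _ - _ *: _)); ring.
Qed.

Let scaled_linear a (f : A -> A) : linear f -> linear (fun x => a *: f x).
Proof. by move=> lf b x y; rewrite lf scalerDr scaleC. Qed.

Lemma triple_bol : bol_superalgebra (supercomm (A := A)) triple.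
Proof.
have triple_grade i j k x y z : x \in grade A i -> y \in grade A j ->
    z \in grade A k -> triple x y z \in grade A (i (+) j (+) k).
  by move=> hx hy hz; apply: rpredZ; apply: qtriple_grade.
have br_grade i j x y : x \in grade A i -> y \in grade A j ->
    supercomm x y \in grade A (i (+) j).
  by move=> hx hy; rewrite (supercommE hx hy); apply: rpredZ; apply: comm_grade.
split.
- exact: (supercomm_bilinear A).1.
- exact: (supercomm_bilinear A).2.
- by move=> y z; apply: (scaled_linear _ (qtriple_linearl y z)).
- by move=> x z; apply: (scaled_linear _ (qtriple_linearm x z)).
- by move=> x y; apply: (scaled_linear _ (qtriple_linearr x y)).
- exact: br_grade.
- exact: triple_grade.
- move=> i j x y hx hy; rewrite (supercommE hx hy) (supercommE hy hx).
  rewrite scaleC -scalerN /comm; congr (_ *: _).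
  case: i j {hx hy} => [] []; rewrite /= ?expr0 ?expr1;
  rewrite ?(scaleN1r, scale1r, opprK); abel.
- move=> i j k x y z hx hy hz; rewrite /triple (qtriple_skew hx hy hz).
  by rewrite scalerN scaleC.
- move=> i j k x y z hx hy hz; rewrite /triple !(scaleC _ 4^-1) -!scalerDr.
  by rewrite !sign_addr (qtriple_cyclic hx hy hz) scaler0.
- move=> i j k l x y u v hx hy hu hv.
  have htu := triple_grade _ _ _ _ _ _ hx hy hu.
  have htv := triple_grade _ _ _ _ _ _ hx hy hv.
  rewrite (supercommE (br_grade _ _ _ _ hu hv) (br_grade _ _ _ _ hx hy)).
  rewrite (supercommE htu hv) (supercommE hu htv).
  rewrite (supercommE hu hv) (supercommE hx hy).
  rewrite /triple !(commZl, commZr) !qtZr (qtriple_comm hx hy hu hv).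
  by rewrite !(sign_addr, sign_addl); apply: rescale.
- move=> i j k l m x y u v w hx hy hu hv hw.
  rewrite /triple !(qtZl, qtZm, qtZr) (qtriple_derivation hx hy hu hv hw).
  rewrite (mulnC k) !(sign_addr, sign_addl) !scalerDr.
  by rewrite !(scaleC 4^-1 (_ ^+ _)).
Qed.

End RightAlternative.

Local Close Scope ring_scope.

Theorem theorem3p1 (K : fieldType) (hK2 : 2 \notin [pchar K]%R)
    (hK3 : 3 \notin [pchar K]%R) (A : superalgebra K)
    (hA : right_alternative A) :
  exists tr : A -> A -> A -> A, bol_superalgebra (supercomm (A := A)) tr.
Proof. exists (@triple K A); exact: triple_bol. Qed.
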